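(* Let $k \geq 1$, and let $q_{0}, \dots, q_{k-1} \in \mathbb{N}^{*}$ be free ultrafilters on $\mathbb{N}$ with $E_{t}^{(k)} \in q_{t}$ for each $t \in \{0, \dots, k-1\}$. Then $$p := q_{0} + q_{1} + \cdots + q_{k-1} \in \Sigma_{k} \setminus \Sigma_{k+1}.$$
   Context: $\mathbb{N} = \{1,2,3,\dots\}$ is discrete; $\beta\mathbb{N}$ is the space of ultrafilters on $\mathbb{N}$, with basis of clopen sets $\overline{A} = \{p \in \beta\mathbb{N} : A \in p\}$ for $A \subseteq \mathbb{N}$; each $n\in\mathbb{N}$ is identified with the principal ultrafilter at $n$, and $\mathbb{N}^{*} = \beta\mathbb{N} \setminus \mathbb{N}$ is the set of free (non-principal) ultrafilters. Addition on $\beta\mathbb{N}$ is defined by $A \in p + q \iff \{n \in \mathbb{N} : -n + A \in q\} \in p$, where $-n + A = \{m \in \mathbb{N} : n + m \in A\}$; it is associative, and for each fixed $q$ the map $p \mapsto p+q$ is continuous. The cumulative depth filtration is defined by $\Sigma_{0} = \beta\mathbb{N}$, $\Sigma_{1} = \mathbb{N}^{*}$, and $\Sigma_{k+1} = \overline{\mathbb{N}^{*} + \Sigma_{k}}$ for $k \geq 1$, where $\mathbb{N}^{*} + \Sigma_{k} = \{r + v : r \in \mathbb{N}^{*}, v \in \Sigma_{k}\}$ and the closure is taken in $\beta\mathbb{N}$. Let $e_{n} = 2^{2^{n}}$ for $n \geq 1$. For $k \geq 1$ and $t \in \{0, \dots, k-1\}$, $E_{t}^{(k)} = \{ e_{n}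 : n \geq 1,\ n \equiv t \pmod k \}$. *)

(* Defs.v *)
From HB Require Import structures.
From mathcomp Require Import all_boot all_order.
From mathcomp Require Import boolp classical_sets functions filter topology.

Set Implicit Arguments.
Unset Strict Implicit.
Unset Printing Implicit Defensive.

Local Open Scope classical_set_scope.

(* N = {1, 2, 3, ...}: zero is excluded, so addition has no neutral element. *)
Definition pnat := {n : nat | (0 < n)%N}.

Lemma paddn_gt0 (m n : pnat) : (0 < val m + val n)%N.
Proof. by rewrite addn_gt0 (valP m). Qed.

Definition paddn (m n : pnat) : pnat := Sub (val m + val n)%N (paddn_gt0 m n).

Record betaN := BetaN {
  ultra :> set pnat -> Prop;
  ultraP : UltraFilter ultra }.
#[global] Existing Instance ultraP.

HB.instance Definition _ := gen_eqMixin betaN.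
HB.instance Definition _ := gen_choiceMixin betaN.

Lemma betaN_eq (p q : betaN) : (forall A : set pnat, p A <-> q A) -> p = q.
Proof.
case: p q => [p pU] [q qU] /= pq.
have {}pq : p = q by apply/funext => A; exact/propext.
by subst q; congr BetaN; exact: Prop_irrelevance.
Qed.

Lemma ultra_setC (p : betaN) (A : set pnat) : p (~` A) <-> ~ p A.
Proof.
split=> [pCA pA|npA]; last by case: (in_ultra_setVsetC A (ultraP p)).
by apply: (@filter_not_empty _ (ultra p) _); rewrite -(setICr A); exact: filterI.
Qed.

Definition basic (A : set pnat) : set betaN := [set p : betaN | p A].

Lemma basic_cover : \bigcup_(A in [set: set pnat]) basic A = setT.
Proof. by rewrite -subTset => p _; exists setT => //; exact: filterT. Qed.

Lemma basic_join (A B : set pnat) (p : betaN) :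
    [set: set pnat] A -> [set: set pnat] B -> basic A p -> basic B p ->
  exists C, [/\ [set: set pnat] C, basic C p & basic C `<=` basic A `&` basic B].
Proof.
move=> _ _ pA pB; exists (A `&` B); split => //; first exact: filterI.
by move=> q qAB; split; apply: filterS qAB => x [].
Qed.

HB.instance Definition _ :=
  isBaseTopological.Build betaN basic_cover basic_join.

Definition principal (n : pnat) : betaN := BetaN (principal_filter_ultra n).

Definition Nstar : set betaN := ~` range principal.

Definition shift (n : pnat) (A : set pnat) : set pnat :=
  [set m | A (paddn n m)].

Definition add_system (p q : betaN) : set_system pnat :=
  [set A | p [set n | q (shift n A)]].

Lemma add_ultra (p q : betaN) : UltraFilter (add_system p q).
Proof.
have addF : ProperFilter (add_system p q).
  split; last split.
  - move=> p0; have {}p0 : p [set n | q (shift n set0)] by [].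
    apply: (@filter_not_empty _ (ultra p) _).
    by apply: filterS p0 => n q0; exact: (@filter_not_empty _ (ultra q) _ q0).
  - suff: p [set n | q (shift n setT)] by [].
    by apply: filterS filterT => n _; exact: filterT.
  - move=> A B pA pB.
    have {}pA : p [set n | q (shift n A)] by [].
    have {}pB : p [set n | q (shift n B)] by [].
    suff: p [set n | q (shift n (A `&` B))] by [].
    by apply: filterS (filterI pA pB) => n [qA qB]; exact: filterI.
  - move=> A B AB pA; have {}pA : p [set n | q (shift n A)] by [].
    suff: p [set n | q (shift n B)] by [].
    by apply: filterS pA => n; apply: filterS => m; exact: AB.
split=> // G GF sG; rewrite eqEsubset; split=> // A GA.
apply: contrapT => /(ultra_setC p) pCA.
apply: (@filter_not_empty _ G _); rewrite -(setICr A); apply: filterI => //.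
apply: sG; suff: p [set n | q (shift n (~` A))] by [].
by apply: filterS pCA => n /(ultra_setC q).
Qed.

Definition betaN_add (p q : betaN) : betaN := BetaN (add_ultra p q).

Lemma betaN_addA : associative betaN_add.
Proof.
move=> p q r; apply: betaN_eq => A.
suff E m n : shift n (shift m A) = shift (paddn m n) A.
  rewrite /betaN_add /add_system /=.
  by split; apply: filterS => m; apply: filterS => n; rewrite /= E.
by apply/funext => j; congr A; apply: val_inj; rewrite /= addnA.
Qed.

Definition add_set (S T : set betaN) : set betaN :=
  [set betaN_add r v | r in S & v in T].

Fixpoint Sigma (k : nat) : set betaN :=
  match k with
  | 0 => setT
  | 1 => Nstar
  | j.+1 => closure (add_set Nstar (Sigma j))
  end.

(* There is no neutral element in betaN, hence the separate first term:
   betaN_sum q k is q 0 + q 1 + ... + q (k - 1) for 0 < k. *)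
Definition betaN_sum (q : nat -> betaN) (k : nat) : betaN :=
  foldl betaN_add (q 0) [seq q t | t <- iota 1 k.-1].

Lemma e_gt0 (n : pnat) : (0 < 2 ^ (2 ^ val n))%N.
Proof. by rewrite expn_gt0. Qed.

Definition e (n : pnat) : pnat := Sub (2 ^ (2 ^ val n))%N (e_gt0 n).

Definition E (k t : nat) : set pnat :=
  [set e n | n in [set n : pnat | val n = t %[mod k]]].

(* Main.v *)
(** Let [S_j] be the set of sums of [j] numbers of the form [2^(2^a)]. The sum
    [q_0 + ... + q_(k-1)] contains [S_k], so it suffices that no ultrafilter in
    [Sigma (j+1)] contains a translate of [S_j]; this goes by induction on [j].
    If [r] is free and [r + v] contains a translate of [S_(j+1)], then [v]
    contains two different translates of [S_(j+1)]. A point in both gives two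
    elements of [S_(j+1)] with a fixed difference [d > 0]. They cannot both be
    multiples of [2^(2^d) > d], so one of them has a summand [2^(2^a)] with
    [a < d]. Hence [v] contains one of finitely many translates of [S_j]. *)
Require Import Defs.
From mathcomp Require Import all_boot all_order.
From mathcomp Require Import boolp classical_sets functions filter topology.

Local Open Scope classical_set_scope.

Definition tower_sums (j : nat) : set nat :=
  [set x | exists2 s : seq nat, size s = j & x = \sum_(a <- s) 2 ^ (2 ^ a)].

Lemma tower_sums0 (x : nat) : tower_sums 0 x -> x = 0.
Proof. by case=> s /size0nil -> ->; rewrite big_nil. Qed.

Lemma tower_sumsD (i j x y : nat) :
  tower_sums i x -> tower_sums j y -> tower_sums (i + j) (x + y).
Proof.
by move=> [s <- ->] [t <- ->]; exists (s ++ t); rewrite ?size_cat ?big_cat.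
Qed.

(** If no exponent lies below [l], every summand is a multiple of [2 ^ (2 ^ l)]; otherwise a summand
    with [a < l] can be removed. The bound on [x] keeps the truncated subtraction exact. *)
Lemma tower_sums_dvd_or_small (l j x : nat) : tower_sums j.+1 x ->
  2 ^ (2 ^ l) %| x \/
  exists2 a : 'I_l, 2 ^ (2 ^ a) <= x & tower_sums j (x - 2 ^ (2 ^ a)).
Proof.
case=> s sj ->; have [/hasP[a sa al]|/hasPn large] := boolP (has (ltn^~ l) s).
  right; exists (Ordinal al); rewrite (big_rem a) //= ?leq_addr // addKn.
  by exists (rem a s); rewrite // size_rem // sj.
left; rewrite big_seq; apply: dvdn_sum => a /large /=; rewrite -leqNgt => la.
by rewrite dvdn_exp2l // leq_exp2l.
Qed.

(** The translate by [c - n], written without subtraction: shifts increase [n], removed summands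
    increase [c]. *)
Definition tower_translate (j n c : nat) : set Defs.pnat :=
  [set m | exists2 y, tower_sums j y & val m + n = c + y].

Lemma shift_tower_translate (x : Defs.pnat) (j n c : nat) :
  shift x (tower_translate j n c) = tower_translate j (val x + n) c.
Proof.
by apply/funext => m; rewrite /shift /tower_translate /= addnCA addnA.
Qed.

Lemma tower_translate_meet (j n n' c : nat) (m : Defs.pnat) : n < n' ->
  tower_translate j.+1 n c m -> tower_translate j.+1 n' c m ->
  exists a : 'I_(n' - n), tower_translate j n (c + 2 ^ (2 ^ a)) m \/
                          tower_translate j n' (c + 2 ^ (2 ^ a)) m.
Proof.
move=> nn' [y yS yE] [y' yS' yE'].
have [dy|[a ay Sy]] := tower_sums_dvd_or_small (n' - n) _ _ yS; last first.
  by exists a; left; exists (y - 2 ^ (2 ^ a)); rewrite // -addnA subnKC.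
have [dy'|[a ay Sy]] := tower_sums_dvd_or_small (n' - n) _ _ yS'; last first.
  by exists a; right; exists (y' - 2 ^ (2 ^ a)); rewrite // -addnA subnKC.
have dE : y' - y = n' - n.
  by rewrite -(subnDl c) -yE -yE' subnDl.
(* With [d = n' - n > 0], divisibility would give [2 ^ (2 ^ d) <= d], against
   [d < 2 ^ d < 2 ^ (2 ^ d)]. *)
have := dvdn_sub dy' dy; rewrite dE => /dvdn_leq; rewrite subn_gt0 => /(_ nn').
by rewrite leqNgt (ltn_trans (ltn_expl _ (ltnSn 1))) // ltn_expl.
Qed.

Lemma Nstar_setC1 (r : betaN) (x : Defs.pnat) : Nstar r -> r (~` [set x]).
Proof.
move=> rfree; apply/ultra_setC => rx; apply: rfree; exists x => //.
apply: betaN_eq => A; split=> [/principal_filterP Ax|rA].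
  by apply: filterS rx => _ ->.
apply/principal_filterP.
by have [_ [-> Ax]] := filter_ex (filterI rx rA); exact: Ax.
Qed.

Lemma Nstar_two_points (r : betaN) (A : set Defs.pnat) : Nstar r -> r A ->
  exists x y : Defs.pnat, [/\ A x, A y & val x < val y].
Proof.
move=> rfree rA; have [x Ax] := filter_ex rA.
have [y [Ay yx]] := filter_ex (filterI rA (Nstar_setC1 _ x rfree)).
have /eqP : val x <> val y by move/val_inj => xy; exact: yx.
by rewrite neq_ltn => /orP[xy|xy]; [exists x, y|exists y, x].
Qed.

Lemma Sigma_not_tower_translate (j n c : nat) (w : betaN) :
  Sigma j.+1 w -> ~ w (tower_translate j n c).
Proof.
elim: j => [|j IH] in n c w *.
  (* The only empty sum is 0, so this translate has at most one point. *)
  move=> wfree wT; have [x [y [[u u0 xE] [v v0 yE]]]] :=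
    Nstar_two_points _ _ wfree wT.
  by rewrite -(ltn_add2r n) xE yE (tower_sums0 _ u0) (tower_sums0 _ v0) ltnn.
move=> wS wT.
(* A basic set containing [w] is open, so it meets the set whose closure is taken; this replaces [w]
   by some [r + v]. *)
have nT : nbhs w (basic (tower_translate j.+1 n c)).
  apply: open_nbhs_nbhs; split=> //.
  by exists [set tower_translate j.+1 n c] => //; rewrite bigcup_set1.
have [_ [[r rfree [v vS <-]] rvT]] := wS _ nT.
have [x [x' [vx vx' xx']]] := Nstar_two_points _ _ rfree rvT.
move: vx vx'; rewrite /= !shift_tower_translate => vx vx'.
(* Only finitely many [a] occur, so the complements given by [IH] intersect in a member of [v]. *)
have small : v [set m | forall a : 'I_(val x' + n - (val x + n)),
    ~ (tower_translate j (val x + n) (c + 2 ^ (2 ^ a)) m \/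
       tower_translate j (val x' + n) (c + 2 ^ (2 ^ a)) m)].
  apply: filter_forall => a; apply: filterS
    (filterI ((ultra_setC _ _).2 (IH (val x + n) (c + 2 ^ (2 ^ a)) v vS))
             ((ultra_setC _ _).2 (IH (val x' + n) (c + 2 ^ (2 ^ a)) v vS))).
  by move=> m [? ?] [].
have [m [[mx mx'] msmall]] := filter_ex (filterI (filterI vx vx') small).
have [|a] := tower_translate_meet _ _ _ _ _ _ mx mx'; first by rewrite ltn_add2r.
exact: msmall.
Qed.

(** The sum is nested to the left, while [Sigma] splits off the leftmost term. *)
Lemma foldl_betaN_add (p q : betaN) (s : seq betaN) :
  foldl betaN_add (betaN_add p q) s = betaN_add p (foldl betaN_add q s).
Proof. by elim: s q => //= r s IH q; rewrite -betaN_addA IH. Qed.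

Lemma foldl_Sigma (p : betaN) (s : seq betaN) :
  Nstar p -> {in s, forall r, Nstar r} ->
  Sigma (size s).+1 (foldl betaN_add p s).
Proof.
elim: s p => //= q s IH p pfree sfree; rewrite foldl_betaN_add.
apply: subset_closure; exists p => //; exists (foldl betaN_add q s) => //.
by apply: IH => [|r rs]; apply: sfree; rewrite inE ?eqxx ?rs ?orbT.
Qed.

Lemma foldl_tower_sums (i : nat) (p : betaN) (s : seq betaN) :
  p (val @^-1` tower_sums i) ->
  {in s, forall r : betaN, r (val @^-1` tower_sums 1)} ->
  foldl betaN_add p s (val @^-1` tower_sums (i + size s)).
Proof.
elim: s i p => [|q s IH] i p pS sS /=; first by rewrite addn0.
rewrite -addSnnS; apply: IH => [|r rs]; last by apply: sS; rewrite inE rs orbT.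
have qS : q (val @^-1` tower_sums 1) by apply: sS; rewrite inE eqxx.
suff: p [set n | q (shift n (val @^-1` tower_sums i.+1))] by [].
apply: filterS pS => m mS; apply: filterS qS => n nS.
by have := tower_sumsD _ _ _ _ mS nS; rewrite addn1.
Qed.

Lemma E_sub_tower_sums (k t : nat) : E k t `<=` val @^-1` tower_sums 1.
Proof. by move=> _ [n _ <-]; exists [:: val n]; rewrite //= big_seq1. Qed.

Theorem theorem1p2 (k : nat) (hk : (1 <= k)%N) (q : nat -> betaN)
    (hfree : forall t : nat, (t < k)%N -> Nstar (q t))
    (hE : forall t : nat, (t < k)%N -> q t (E k t)) :
  (Sigma k `\` Sigma k.+1) (betaN_sum q k).
Proof.
have tail r : r \in [seq q t | t <- iota 1 k.-1] -> exists2 t, t < k & r = q t.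
  case/mapP=> t; rewrite mem_iota add1n prednK // => /andP[_ tk] ->.
  by exists t.
have szE : (size [seq q t | t <- iota 1 k.-1]).+1 = k.
  by rewrite size_map size_iota prednK.
have tS t : t < k -> q t (val @^-1` tower_sums 1).
  by move=> /hE; apply: filterS; exact: E_sub_tower_sums.
split.
  rewrite -[X in Sigma X]szE; apply: foldl_Sigma; first exact: hfree.
  by move=> r /tail[t tk ->]; exact: hfree.
(* For [n = c = 0] the translate is [tower_sums k] itself, restricted to positive numbers. *)
move=> /(Sigma_not_tower_translate k 0 0); apply.
have : betaN_sum q k (val @^-1` tower_sums k).
  rewrite -[X in tower_sums X]szE.
  by apply: (foldl_tower_sums 1) => [|r /tail[t tk ->]]; exact: tS.
by apply: filterS => m mS; exists (val m); rewrite ?addn0.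
Qed.
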